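(* Let $\mathbb{F}=\mathbb{R}$, let $N\ge2$, $M\ge2$ and $Q$ be integers with $1\le Q\le M-1$, write $\mathcal{M}=\{1,\dots,M\}$, let $0<\epsilon<1$, and let $\mathbf{H}_1,\dots,\mathbf{H}_M$ be $N\times N$ real symmetric positive semidefinite matrices. Let $v^{\min}_{\rm QP}$ be the optimal value of (P1): minimize $\|\mathbf{w}\|^2$ over $\mathbf{w}\in\mathbb{R}^N$, $\boldsymbol\beta\in\{0,1\}^M$ subject to $\mathbf{w}^T\mathbf{H}_i\mathbf{w}\ge\beta_i+(1-\beta_i)\epsilon$ ($i\in\mathcal{M}$) and $\sum_{i}\beta_i=Q$; and let $v^{\min}_{\rm SDP2}$ be the optimal value of (SDP2): minimize $\mathrm{Tr}[\mathbf{X}]$ over real symmetric $N\times N$ matrices $\mathbf{X}\succeq0$ and $\boldsymbol\beta\in\mathbb{R}^M$ subject to $\mathrm{Tr}[\mathbf{H}_i\mathbf{X}]\ge\beta_i+(1-\beta_i)\epsilon$ ($i\in\mathcal{M}$), $\sum_i\beta_i=Q$, $0\le\beta_i\le1$. Then $$v^{\min}_{\rm QP}\le\bar\mu_{\mathbb{R}}\,v^{\min}_{\rm SDP2},\qquad \bar\mu_{\mathbb{R}}=\max\left\{\frac{27\Big[M-Q+\sqrt{\tfrac{1}{c(\epsilon)}}\,Q\Big]^2}{\pi},\ \frac{12(\sqrt{2M}-1)^2}{(\pi-2)^2c(\epsilon)}\right\},$$ where $c(\epsilon)=\epsilon+\frac{1-\epsilon}{M-Q+1}$. *)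

(* Defs.v *)
From HB Require Import structures.
From mathcomp Require Import all_boot all_order all_algebra.
From mathcomp Require Import all_classical all_reals.
From mathcomp Require Import ereal trigo.
Set Implicit Arguments. Unset Strict Implicit. Unset Printing Implicit Defensive.
Import Order.TTheory GRing.Theory Num.Theory.
Local Open Scope ring_scope.
Local Open Scope classical_set_scope.

Definition qform (R : realType) (N : nat) (A : 'M[R]_N) (x : 'cV[R]_N) : R :=
  (x^T *m A *m x) 0 0.

Definition psd (R : realType) (N : nat) (A : 'M[R]_N) : Prop :=
  A^T = A /\ forall x : 'cV[R]_N, 0 <= qform A x.

Definition sqnorm (R : realType) (N : nat) (w : 'cV[R]_N) : R :=
  \sum_(i < N) (w i 0) ^+ 2.

Definition P1_feasible (R : realType) (N M Q : nat) (eps : R)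
  (H : 'I_M -> 'M[R]_N) (w : 'cV[R]_N) (beta : 'I_M -> R) : Prop :=
  (forall i, beta i = 0 \/ beta i = 1) /\
  (forall i, qform (H i) w >= beta i + (1 - beta i) * eps) /\
  \sum_(i < M) beta i = Q%:R.

Definition SDP2_feasible (R : realType) (N M Q : nat) (eps : R)
  (H : 'I_M -> 'M[R]_N) (X : 'M[R]_N) (beta : 'I_M -> R) : Prop :=
  psd X /\
  (forall i, \tr (H i *m X) >= beta i + (1 - beta i) * eps) /\
  \sum_(i < M) beta i = Q%:R /\
  (forall i, 0 <= beta i <= 1).

(* optimal values (infima, in extended reals; +oo if infeasible) *)
Definition v_QP (R : realType) (N M Q : nat) (eps : R) (H : 'I_M -> 'M[R]_N)
  : \bar R :=
  ereal_inf [set (sqnorm w)%:E | w in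
     [set w : 'cV[R]_N | exists beta, P1_feasible Q eps H w beta]].

Definition v_SDP2 (R : realType) (N M Q : nat) (eps : R) (H : 'I_M -> 'M[R]_N)
  : \bar R :=
  ereal_inf [set (\tr X)%:E | X in
     [set X : 'M[R]_N | exists beta, SDP2_feasible Q eps H X beta]].

Definition c_eps (R : realType) (M Q : nat) (eps : R) : R :=
  eps + (1 - eps) / (M - Q + 1)%:R.

Definition mu_bar (R : realType) (M Q : nat) (eps : R) : R :=
  Num.max
    (27 * ((M - Q)%:R + Num.sqrt ((c_eps M Q eps)^-1) * Q%:R) ^+ 2 / pi)
    (12 * (Num.sqrt (2 * M%:R) - 1) ^+ 2 / ((pi - 2) ^+ 2 * c_eps M Q eps)).

(* Main.v *)
(* For [(X, beta)] feasible in (SDP2), at least [Q] of the [beta i] are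
   [>= 1/(M-Q+1)], hence [Tr (H_i X) >= t_i] with [t_i = c(eps)] for [Q] of the
   indices and [t_i = eps] for the others; put [s_i = 1], resp. [s_i = eps].
   Each [H_i] dominates a rank one matrix [h_i h_i^T] with
   [|h_i|^2 >= t_i / Tr X].  By Bang's plank lemma some signed sum [w] of the
   vectors [sqrt s_i / |h_i|^2 *: h_i] satisfies [<h_i, w>^2 >= s_i] for all
   [i], so [w] is feasible in (P1).  By the triangle inequality
   [|w| <= sum_i sqrt s_i / |h_i| <= (M - Q + Q / sqrt c(eps)) sqrt (Tr X)],
   and [27 / pi >= 1]: already the first term of the maximum suffices. *)
Require Import Defs.
From HB Require Import structures.
From mathcomp Require Import all_boot all_order all_algebra.
From mathcomp Require Import all_classical all_reals.
From mathcomp Require Import ereal trigo.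
From mathcomp Require Import ring lra.
Import Order.TTheory GRing.Theory Num.Theory.
Local Open Scope ring_scope.

(** * Bilinear forms, Cauchy-Schwarz and the triangle inequality *)

Definition bform {R : realType} {N : nat} (A : 'M[R]_N) (x y : 'cV[R]_N) : R :=
  (x^T *m A *m y) 0 0.

Local Notation dot := (bform 1%:M).

Section BilinearForm.
Context {R : realType} {N : nat}.
Implicit Types (A B X : 'M[R]_N) (x y z : 'cV[R]_N).

Lemma bformDr A x y z : bform A x (y + z) = bform A x y + bform A x z.
Proof. by rewrite /bform mulmxDr mxE. Qed.

Lemma bformZr A a x y : bform A x (a *: y) = a * bform A x y.
Proof. by rewrite /bform -scalemxAr mxE. Qed.

Lemma bform_tr A x y : bform A^T x y = bform A y x.
Proof.
rewrite /bform; have -> : x^T *m A^T *m y = (y^T *m A *m x)^T.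
  by rewrite !trmx_mul trmxK mulmxA.
by rewrite mxE.
Qed.

Lemma bformC A x y : A^T = A -> bform A x y = bform A y x.
Proof. by move=> sA; rewrite -bform_tr sA. Qed.

Lemma bform_comb A x y a b : A^T = A ->
  qform A (a *: x + b *: y) =
  a ^+ 2 * qform A x + 2 * a * b * bform A x y + b ^+ 2 * qform A y.
Proof.
move=> sA; have qE z : qform A z = bform A z z by [].
rewrite qE bformDr !bformZr ![bform A (_ + _) _]bformC // !bformDr !bformZr.
by rewrite (bformC A y x) // -!qE; ring.
Qed.

Lemma bform_CauchySchwarz A x y : psd A ->
  bform A x y ^+ 2 <= qform A x * qform A y.
Proof.
move=> [sA pA]; have := pA x; have := pA y.
(* With [p], [q], [b] as named below, this vector gives [0 <= q * (p * q - b ^+ 2)], enough when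
   [0 < q]. The next one handles [q = 0]: it gives [b ^+ 2 * (p + 2) <= 0], so [b = 0]. *)
have := pA (qform A y *: x + (- bform A x y) *: y).
have := pA ((- bform A x y) *: x + (qform A x + 1) *: y).
rewrite !bform_comb //; move: (qform A x) (qform A y) (bform A x y) => p q b.
move=> h1 h2; rewrite le_eqVlt => /predU1P[q0|q0] p0.
  rewrite -q0 mulr0 in h1 *.
  have : b ^+ 2 * (p + 2) <= 0 by lra.
  by rewrite pmulr_lle0 //; lra.
have : 0 <= q * (p * q - b ^+ 2) by apply: le_trans h2 _; lra.
by rewrite pmulr_rge0 // subr_ge0.
Qed.

Lemma sqnormE x : sqnorm x = qform 1%:M x.
Proof.
by rewrite /sqnorm /qform mulmx1 mxE; apply: eq_bigr => i _; rewrite mxE expr2.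
Qed.

Lemma sqnorm_ge0 x : 0 <= sqnorm x.
Proof. by apply: sumr_ge0 => i _; apply: sqr_ge0. Qed.

Lemma sqnorm_eq0 x : sqnorm x = 0 -> x = 0.
Proof.
move=> /psumr_eq0P x0; apply/matrixP => i j; rewrite ord1 mxE.
by apply/eqP; rewrite -sqrf_eq0 x0 // => k _; apply: sqr_ge0.
Qed.

Lemma sqnormZ a x : sqnorm (a *: x) = a ^+ 2 * sqnorm x.
Proof. by rewrite /sqnorm mulr_sumr; apply: eq_bigr => i _; rewrite mxE exprMn. Qed.

Lemma sqnormD x y : sqnorm (x + y) = sqnorm x + 2 * dot x y + sqnorm y.
Proof.
rewrite !sqnormE -[in LHS](scale1r x) -[in LHS](scale1r y).
by rewrite bform_comb ?trmx1 // !mulr1 expr1n !mul1r.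
Qed.

Lemma psd1 : psd (1%:M : 'M[R]_N).
Proof. by split=> [|x]; rewrite ?trmx1 // -sqnormE sqnorm_ge0. Qed.

Lemma dot_CauchySchwarz x y : dot x y ^+ 2 <= sqnorm x * sqnorm y.
Proof. by rewrite !sqnormE; apply: bform_CauchySchwarz psd1. Qed.

Lemma bform_dot A x y : A^T = A -> bform A x y = dot (A *m x) y.
Proof. by move=> sA; rewrite /bform mulmx1 trmx_mul sA. Qed.

Lemma sqnorm_sum_le (I : finType) (x : I -> 'cV[R]_N) (n : I -> R) :
  (forall i, 0 <= n i) -> (forall i, sqnorm (x i) <= n i ^+ 2) ->
  sqnorm (\sum_i x i) <= (\sum_i n i) ^+ 2.
Proof.
move=> n0 xn.
(* The induction also carries the sign of the partial sums, needed to bound the cross term by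
   [a * b]. *)
suff [] : 0 <= \sum_i n i /\ sqnorm (\sum_i x i) <= (\sum_i n i) ^+ 2 by [].
apply: (big_ind2 (fun a y => 0 <= a /\ sqnorm y <= a ^+ 2)) => [|a y b z|i _].
- split=> //; rewrite /sqnorm big1 ?expr0n // => i _.
  by rewrite mxE expr0n.
- move=> [a0 ya] [b0 zb]; split; first exact: addr_ge0.
  have dab : dot y z <= a * b.
    rewrite (le_trans (ler_norm _)) // -(ler_pXn2r (ltn0Sn 1)) ?nnegrE ?mulr_ge0 //.
    rewrite -normrX ger0_norm ?sqr_ge0 // exprMn.
    by rewrite (le_trans (dot_CauchySchwarz y z)) // ler_pM ?sqnorm_ge0.
  by rewrite sqnormD; lra.
- by [].
Qed.

(** * Positive semidefinite matrices and rank one terms *)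

Lemma tr_mul_outer A x : \tr (A *m (x *m x^T)) = qform A x.
Proof. by rewrite mulmxA mxtrace_mulC mulmxA trace_mx11. Qed.

Lemma bform_delta A i j : bform A (delta_mx i 0) (delta_mx j 0) = A i j.
Proof.
by rewrite /bform trmx_delta -rowE mxE (bigD1 j) //= big1 => [|k /negPf kj];
  rewrite !mxE ?eqxx ?kj ?mulr1 ?addr0 ?mulr0.
Qed.

Lemma psd_diag_ge0 A i : psd A -> 0 <= A i i.
Proof. by move=> [_ pA]; rewrite -bform_delta; apply: pA. Qed.

Lemma psd_tr_ge0 A : psd A -> 0 <= \tr A.
Proof. by move=> pA; apply: sumr_ge0 => i _; apply: psd_diag_ge0. Qed.

(** Cauchy-Schwarz on two basis vectors. It serves to show that a zero diagonal entry annihilates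
    its whole row. *)
Lemma psd_entry_le A i j : psd A -> A i j ^+ 2 <= A i i * A j j.
Proof.
move=> pA; rewrite -(bform_delta A i j).
rewrite (le_trans (bform_CauchySchwarz _ _ _ pA)) //.
by rewrite /qform -/(bform A _ _) -/(bform A (delta_mx j 0) _) !bform_delta.
Qed.

Lemma mulmx_outerE x i j : (x *m x^T) i j = x i 0 * x j 0.
Proof. by rewrite mxE big_ord1 mxE. Qed.

(* One step of Gaussian elimination on a nonzero pivot [X k k]; by
   Cauchy-Schwarz the Schur complement is psd and has no new nonzero diagonal
   entry. *)
Lemma psd_sum_outer X : psd X ->
  exists s : seq 'cV[R]_N, X = \sum_(v <- s) v *m v^T.
Proof.
have [n] := ubnP #|[set i | X i i != 0]|; elim: n X => // n IHn X Xn pX.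
have [sX _] := pX.
have [[k Xk0]|X0] := pselect (exists k, X k k != 0); last first.
  exists [::]; rewrite big_nil; apply/matrixP => i j; rewrite mxE.
  have Xi0 : X i i = 0 by apply/eqP/negPn/negP => Xi; apply: X0; exists i.
  have := psd_entry_le X i j pX.
  by rewrite Xi0 mul0r => Xij; apply/eqP; rewrite -sqrf_eq0 eq_le Xij sqr_ge0.
have Xk : 0 < X k k by rewrite lt_neqAle eq_sym Xk0 psd_diag_ge0.
(* The scaling makes [v *m v^T] agree with [X] on row and column [k]. *)
pose v := (Num.sqrt (X k k))^-1 *: (X *m delta_mx k 0) : 'cV[R]_N.
have vE i : v i 0 = (Num.sqrt (X k k))^-1 * X i k.
  by rewrite mxE -colE mxE.
have vvE i j : (v *m v^T) i j = X i k * X j k / X k k.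
  rewrite mulmx_outerE !vE -[in RHS](@sqr_sqrtr _ (X k k)) ?ltW //.
  by field; rewrite gt_eqF // sqrtr_gt0.
have [||s Es] := IHn (X - v *m v^T).
- rewrite -ltnS (leq_trans _ Xn) // ltnS; apply/proper_card/properP; split.
    apply/fintype.subsetP => i; rewrite !inE => Yi; apply: contraNneq Yi => Xi0.
    rewrite mxE [in X in _ + X]mxE vvE Xi0.
    have := psd_entry_le X i k pX; rewrite Xi0 mul0r => Xik.
    have /eqP : X i k ^+ 2 == 0 by rewrite eq_le Xik sqr_ge0.
    by rewrite expr2 => ->; rewrite mul0r subrr.
  exists k; rewrite !inE // mxE [in X in _ + X]mxE vvE negbK.
  by rewrite mulfK // subrr.
- split=> [|x]; first by rewrite linearB /= trmx_mul trmxK sX.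
  have -> : qform (X - v *m v^T) x =
      qform X x - bform X x (delta_mx k 0) ^+ 2 / X k k.
    rewrite /qform mulmxBr mulmxBl mxE [in X in _ + X]mxE; congr (_ - _).
    rewrite mulmxA -mulmxA.
    have -> : x^T *m v = (v^T *m x)^T by rewrite trmx_mul trmxK.
    rewrite [X in X = _]mxE big_ord1 [X in X * _]mxE -expr2.
    rewrite /v linearZ /= -scalemxAl mxE exprMn exprVn sqr_sqrtr ?ltW //.
    rewrite [LHS]mulrC; congr (_ ^+ 2 / _).
    by rewrite bformC // bform_dot // /bform mulmx1.
  rewrite subr_ge0 ler_pdivrMr // -[X in _ * X]bform_delta.
  exact: bform_CauchySchwarz.
by exists (v :: s); rewrite big_cons -Es addrC subrK.
Qed.

(* A psd [H] dominates [h h^T] for [h = H v / sqrt (v^T H v)], and averaging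
   over a decomposition of [X] gives a [v] for which [h] is long. *)
Lemma psd_long_minorant A X : psd A -> psd X -> 0 < \tr (A *m X) ->
  exists h : 'cV[R]_N,
    [/\ 0 < sqnorm h, forall w, dot h w ^+ 2 <= qform A w &
        \tr (A *m X) <= sqnorm h * \tr X].
Proof.
move=> pA pX AX0; have [sA qA] := pA.
have [s Xs] := psd_sum_outer X pX.
have AXE : \tr (A *m X) = \sum_(v <- s) qform A v.
  rewrite Xs mulmx_sumr raddf_sum /=.
  by apply: eq_bigr => v _; rewrite tr_mul_outer.
have XE : \tr X = \sum_(v <- s) sqnorm v.
  rewrite Xs raddf_sum /=; apply: eq_bigr => v _.
  by rewrite -[_ *m _]mul1mx tr_mul_outer sqnormE.
have [v Av0 vle] : exists2 v, 0 < qform A v &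
    \tr (A *m X) * sqnorm v <= qform A v * \tr X.
  (* Without such a [v], the differences in [sum0] are all nonnegative with sum zero, so each
     vanishes. Equality meets the second requirement, so the first must fail: [qform A] vanishes on
     [s], against [0 < \tr (A *m X)]. *)
  apply: contrapT => nov.
  have le0 v : qform A v * \tr X <= \tr (A *m X) * sqnorm v.
    rewrite leNgt; apply/negP => lt; apply: nov; exists v; last exact: ltW.
    rewrite lt_neqAle qA andbT; apply/eqP => Av0; move: lt.
    by rewrite -Av0 mul0r ltNge mulr_ge0 ?sqnorm_ge0 // ltW.
  have sum0 : \sum_(v <- s) (\tr (A *m X) * sqnorm v - qform A v * \tr X) = 0.
    by rewrite sumrB -mulr_sumr -mulr_suml -AXE -XE subrr.
  suff Av0 v : v \in s -> qform A v = 0.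
    by move: AX0; rewrite AXE big_seq big1 ?ltxx // => v /Av0.
  move=> vs; apply: contrapT => /eqP Av0; apply: nov; exists v.
    by rewrite lt_neqAle eq_sym Av0 qA.
  move/eqP: sum0; rewrite psumr_eq0 => [/allP/(_ v vs)|u _]; last first.
    by rewrite subr_ge0.
  by rewrite subr_eq0 => /eqP ->.
have v0 : 0 < sqnorm v.
  rewrite lt_neqAle sqnorm_ge0 andbT eq_sym; apply/eqP => /sqnorm_eq0 v0.
  by move: Av0; rewrite v0 /qform mulmx0 mxE ltxx.
have hA : qform A v ^+ 2 <= sqnorm (A *m v) * sqnorm v.
  by rewrite [qform A v]bform_dot // dot_CauchySchwarz.
exists ((Num.sqrt (qform A v))^-1 *: (A *m v)).
have dhE w : dot ((Num.sqrt (qform A v))^-1 *: (A *m v)) w =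
    (Num.sqrt (qform A v))^-1 * bform A v w.
  by rewrite bformC ?trmx1 // bformZr bformC ?trmx1 // -bform_dot.
(* The right side is the squared length of [h]; the left side is the Rayleigh quotient of [v], which
   the choice of [v] makes large. *)
have hle : qform A v / sqnorm v <= (qform A v)^-1 * sqnorm (A *m v).
  by rewrite ler_pdivrMr // -mulrA ler_pdivlMl // -expr2.
rewrite sqnormZ exprVn sqr_sqrtr ?(ltW Av0) //; split.
- by rewrite (lt_le_trans _ hle) ?divr_gt0.
- move=> w; rewrite dhE exprMn exprVn sqr_sqrtr ?(ltW Av0) //.
  by rewrite ler_pdivrMl // bform_CauchySchwarz.
- apply: le_trans (ler_wpM2r (psd_tr_ge0 _ pX) hle).
  by rewrite mulrAC ler_pdivlMr.
Qed.

(** * Signed sums of vectors *)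

(* Bang: flipping one sign of the longest signed sum cannot lengthen it. *)
Lemma bang_signs (M : nat) (h : 'I_M -> 'cV[R]_N) (a : 'I_M -> R) :
  (forall i, 0 < a i) ->
  exists e : 'I_M -> bool,
    let w := \sum_i ((-1) ^+ e i * a i) *: h i in
    forall i, (a i * sqnorm (h i)) ^+ 2 <= dot (h i) w ^+ 2.
Proof.
move=> a0.
pose W (e : {ffun 'I_M -> bool}) := \sum_i ((-1) ^+ e i * a i) *: h i.
have [e _ emax] :=
  @arg_maxP _ R _ [ffun=> false] predT (fun e => sqnorm (W e)) isT.
exists e => /= i; rewrite -/(W e).
pose e' := [ffun j => if j == i then ~~ e i else e j].
have We' : W e' = W e + (- 2 * ((-1) ^+ e i * a i)) *: h i.
  rewrite /W (bigD1 i) //= [in RHS](bigD1 i) //= addrAC -scalerDl; congr (_ + _).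
    by rewrite ffunE eqxx signrN; congr (_ *: _); ring.
  by apply: eq_bigr => j /negPf ji; rewrite ffunE ji.
have := emax e' isT; rewrite /= We' sqnormD bformZr sqnormZ.
rewrite (bformC (1%:M) (W e)) ?trmx1 //.
have := sqnorm_ge0 (h i); have := a0 i.
move: (a i) (sqnorm (h i)) (dot _ _) => b n d b0 n0.
have bn0 : 0 <= b * n by rewrite mulr_ge0 // ltW.
(* Maximality bounds [b * (b * n)] by [b * d] times the sign given by [e i]; cancelling [b] and
   squaring removes the sign. *)
case: (e i); rewrite ?expr1 ?expr0 => hle.
  have : b * (b * n) <= b * (- d) by lra.
  by rewrite ler_pM2l // => bnd; rewrite -[leRHS]sqrrN ler_pXn2r ?nnegrE //; lra.
have : b * (b * n) <= b * d by lra.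
by rewrite ler_pM2l // => bnd; rewrite ler_pXn2r ?nnegrE //; lra.
Qed.
End BilinearForm.

(** * Selection of large coordinates *)

Lemma subset_of_card (T : finType) (A : {set T}) (k : nat) : (k <= #|A|)%N ->
  exists2 S : {set T}, S \subset A & #|S| = k.
Proof.
move=> kA; exists [set x in take k (enum A)].
  by apply/fintype.subsetP => x; rewrite inE => /mem_take; rewrite mem_enum.
rewrite cardsE (card_uniqP _) ?take_uniq ?enum_uniq // size_takel //.
by rewrite -cardE.
Qed.

(** If only [a <= Q - 1] coordinates reach the threshold [d], the sum is below [a + d * (M - a)].
    This is nondecreasing in [a] because [d <= 1], and equals [Q] at [a = Q - 1]. *)
Lemma large_coordinates {R : realType} (M Q : nat) (beta : 'I_M -> R) :
  (1 <= Q <= M)%N -> (forall i, 0 <= beta i <= 1) ->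
  \sum_i beta i = Q%:R ->
  exists2 S : {set 'I_M}, #|S| = Q &
    forall i, i \in S -> (M - Q + 1)%:R^-1 <= beta i.
Proof.
move=> /andP[Q1 QM] b01 sb; set d : R := _^-1.
pose A := [set i | d <= beta i].
have dE : d * (M%:R - Q%:R + 1) = 1.
  by rewrite -natrB // natr1 -addn1 mulVf // pnatr_eq0 addn1.
have QMR : (Q%:R : R) <= M%:R by rewrite ler_nat.
have [QA|AQ] := leqP Q #|A|.
  have [S /fintype.subsetP SA cS] := @subset_of_card _ A Q QA; exists S => // i /SA.
  by rewrite inE.
exfalso.
have cAC : (#|~: A|%:R : R) = M%:R - #|A|%:R.
  by rewrite cardsCs finset.setCK card_ord natrB // -[X in (_ <= X)%N]card_ord max_card.
(* A coordinate below the threshold is what makes the bound on the sum strict. *)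
have [j jA] : exists j, j \in ~: A.
  apply/card_gt0P; rewrite cardsCs finset.setCK card_ord subn_gt0.
  exact: leq_trans AQ QM.
have sA : \sum_(i in A) beta i <= #|A|%:R.
  by rewrite -sumr_const; apply: ler_sum => i _; have /andP[] := b01 i.
have sAC : \sum_(i in ~: A) beta i < d * #|~: A|%:R.
  rewrite mulr_natr -sumr_const; apply: ltr_sum.
    by apply/hasP; exists j; rewrite ?mem_index_enum.
  by move=> i; rewrite !inE -ltNge.
have : \sum_i beta i < #|A|%:R + d * (M%:R - #|A|%:R).
  rewrite (bigID (mem A)) /= -cAC; apply: ler_ltD => //.
  by under eq_bigl => i do rewrite -finset.in_setC.
have aQ : 0 <= Q%:R - 1 - #|A|%:R :> R.
  by rewrite -addrA -opprD subr_ge0 addrC natr1 ler_nat.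
have d1 : 0 <= 1 - d.
  by rewrite subr_ge0 invf_le1 ?ltr0n ?addn1 // ler1n.
by rewrite sb; have := mulr_ge0 aQ d1; lra.
Qed.

(** * Rounding and comparison of the optimal values *)

Lemma SDP2_rounding {R : realType} (N M Q : nat) (eps : R)
    (H : 'I_M -> 'M[R]_N) (X : 'M[R]_N) (beta : 'I_M -> R) :
  (1 <= Q <= M)%N -> 0 < eps < 1 -> (forall i, psd (H i)) ->
  SDP2_feasible Q eps H X beta ->
  exists w beta', P1_feasible Q eps H w beta' /\
    sqnorm w <= ((M - Q)%:R + Num.sqrt (c_eps M Q eps)^-1 * Q%:R) ^+ 2 * \tr X.
Proof.
move=> QM /andP[e0 e1] pH [pX [HX [sb b01]]].
have [S cS bS] := large_coordinates _ _ _ QM b01 sb.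
have d0 : 0 < ((M - Q + 1)%:R : R)^-1 by rewrite invr_gt0 ltr0n addn1.
set c := c_eps M Q eps.
have cE : c = eps + (1 - eps) * (M - Q + 1)%:R^-1 by [].
have c0 : 0 < c by rewrite cE; nra.
pose b i : R := if i \in S then 1 else 0.
pose s i : R := if i \in S then 1 else eps.
pose t i : R := if i \in S then c else eps.
have s0 i : 0 < s i by rewrite /s; case: ifP.
have t0 i : 0 < t i by rewrite /t; case: ifP.
have tHX i : t i <= \tr (H i *m X).
  apply: le_trans (HX i); have /andP[] := b01 i; rewrite /t; case: ifP => [iS|_].
    (* The constraint bound increases with [beta i], as [eps < 1], and equals [c] at the
       threshold. *)
    by have := bS i iS; rewrite cE; nra.
  by nra.
have HX0 i : 0 < \tr (H i *m X) by apply: lt_le_trans (tHX i).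
have /choice[h hP] i := psd_long_minorant _ _ (pH i) pX (HX0 i).
have h0 i : 0 < sqnorm (h i) by have [] := hP i.
(* Chosen so that [a i * sqnorm (h i)] is the square root of [s i], the level required in (P1). *)
pose a i := Num.sqrt (s i) / sqnorm (h i).
have a0 i : 0 < a i by rewrite divr_gt0 ?sqrtr_gt0.
have [e /= we] := bang_signs _ h a a0.
set w := \sum_i _ in we.
exists w, b; split.
  split=> [i|]; first by rewrite /b; case: (i \in S); [right|left].
  split=> [i|]; last first.
    rewrite -cS -sum1_card natr_sum [RHS]big_mkcond /=.
    by apply: eq_bigr => i _; rewrite /b; case: (i \in S).
  have [_ /(_ w) + _] := hP i; apply: le_trans; apply: le_trans (we i).
  rewrite divfK ?gt_eqF // sqr_sqrtr ?(ltW (s0 i)) // /b /s.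
  by case: (i \in S); lra.
have X_ge0 : 0 <= \tr X by apply: psd_tr_ge0.
(* An upper bound for the length of [a i *: h i], since [t i <= sqnorm (h i) * \tr X]. *)
pose n i := Num.sqrt (s i / t i) * Num.sqrt (\tr X).
have -> : ((M - Q)%:R + Num.sqrt c^-1 * Q%:R) ^+ 2 * \tr X = (\sum_i n i) ^+ 2.
  rewrite -mulr_suml exprMn sqr_sqrtr //; congr (_ ^+ 2 * _).
  rewrite (bigID (mem S)) /= addrC; congr (_ + _).
    rewrite (eq_bigr (fun=> 1)) => [|i /negPf iS]; last first.
      by rewrite /s /t iS divff ?sqrtr1 // gt_eqF.
    rewrite sumr_const; congr (_ *+ _).
    have -> : (M - Q)%N = #|~: S| by rewrite cardsCs finset.setCK card_ord cS.
    by apply: eq_card => i; rewrite !inE.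
  rewrite (eq_bigr (fun=> Num.sqrt c^-1)) => [|i iS].
    by rewrite sumr_const cS mulr_natr.
  by rewrite /s /t iS div1r.
apply: sqnorm_sum_le => i; first by rewrite mulr_ge0 ?sqrtr_ge0.
rewrite sqnormZ !exprMn sqrr_sign mul1r exprVn !sqr_sqrtr ?divr_ge0 ?(ltW (s0 i)) ?(ltW (t0 i)) //.
have [_ _ /(le_trans (tHX i)) th] := hP i.
rewrite -mulrA -[in X in _ <= X]mulrA ler_pM2l // expr2 invfM -mulrA.
rewrite mulVf ?gt_eqF // mulr1.
by rewrite ler_pdivlMl // ler_pdivrMr // mulrC.
Qed.

Theorem theorem2p5 (R : realType) (N M Q : nat) (eps : R)
  (H : 'I_M -> 'M[R]_N) :
  (2 <= N)%N -> (2 <= M)%N -> (1 <= Q)%N -> (Q <= M - 1)%N ->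
  0 < eps < 1 ->
  (forall i, psd (H i)) ->
  (v_QP Q eps H <= (mu_bar M Q eps)%:E * v_SDP2 Q eps H)%E.
Proof.
move=> _ M2 Q1 QM1 e01 pH.
have QM : (Q <= M)%N by rewrite (leq_trans QM1) // leq_subr.
set k : R := (M - Q)%:R + Num.sqrt (c_eps M Q eps)^-1 * Q%:R.
have k0 : 0 < k.
  rewrite ltr_pwDl ?mulr_ge0 ?sqrtr_ge0 // ltr0n subn_gt0.
  by rewrite (leq_ltn_trans QM1) // subn1 prednK // ltnW.
have k_le : k ^+ 2 <= mu_bar M Q eps.
  rewrite le_max; apply/orP; left; rewrite -/k ler_pdivlMr ?pi_gt0 //.
  rewrite mulrC ler_pM2r ?exprn_gt0 //.
  have := @pihalf_lt2 R; lra.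
have mu0 : 0 < mu_bar M Q eps by rewrite (lt_le_trans _ k_le) ?exprn_gt0.
(* Dividing by [mu_bar] isolates the infimum of (SDP2), so a bound at each feasible point suffices,
   even if there is none. *)
rewrite -lee_pdivrMl //; apply: le_ereal_inf_tmp => _ [X [beta fX] <-].
rewrite lee_pdivrMl //; have QM' : (1 <= Q <= M)%N by rewrite Q1.
have [w [b [fw wle]]] := SDP2_rounding _ _ _ _ _ _ _ QM' e01 pH fX.
apply: (@le_trans _ _ (sqnorm w)%:E).
  by apply: ereal_inf_lbound; exists w => //; exists b.
rewrite -EFinM lee_fin (le_trans wle) // ler_wpM2r //.
by apply: psd_tr_ge0; case: fX.
Qed.
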